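(* For every positive integer $k$, the generating function $\mathrm{CSG}_k(z)$ of connected graphs of excess $k$ is equal to $$\mathrm{CSG}_k(z)=[y^k]\log\left(1+\sum_{\ell\ge1}\mathrm{SG}^{>0}_\ell(z)\,y^\ell\right).$$
   Context: Graphs are finite simple graphs with labelled vertices $\{1,\dots,n\}$ and unlabelled, unoriented edges. The excess of a graph is its number of edges minus its number of vertices. A graph is positive if every connected component has positive excess (i.e. no component is a tree or contains exactly one cycle). For a family of graphs, the generating function of its members of excess $k$ is $\sum_G\frac{z^{n(G)}}{n(G)!}$, summed over members $G$ of excess $k$, with $n(G)$ the number of vertices; $\mathrm{CSG}_k(z)$ is this series for connected graphs and $\mathrm{SG}^{>0}_\ell(z)$ is the series of positive graphs of excess $\ell$. The logarithm is that of formal power series in $y$. *)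

(* Defs.v *)
(* [boolp] gives formal power series decidable equality and choice, hence     *)
(* canonical ring structures.                                                 *)
From HB Require Import structures.
From mathcomp Require Import all_boot all_order all_algebra.
From mathcomp Require Import boolp zify.

Set Implicit Arguments.
Unset Strict Implicit.
Unset Printing Implicit Defensive.

Import GRing.Theory.
Local Open Scope ring_scope.

Record fps (R : Type) : Type := Fps { coefs : nat -> R }.

Definition coefps (R : Type) (k : nat) (F : fps R) : R := coefs F k.

HB.instance Definition _ (R : Type) := gen_eqMixin (fps R).
HB.instance Definition _ (R : Type) := gen_choiceMixin (fps R).

Lemma fpsP (R : Type) (F G : fps R) :
  (forall k, coefps k F = coefps k G) <-> F = G.
Proof.
split=> [|-> //]; case: F => f; case: G => g /= fg.
by congr Fps; apply: functional_extensionality_dep.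
Qed.

Section FpsRing.
Variable R : comNzRingType.
Implicit Types F G H : fps R.

Definition fps0 : fps R := Fps (fun=> 0).
Definition fps1 : fps R := Fps (fun k => (k == 0)%:R).
Definition fpsN F : fps R := Fps (fun k => - coefps k F).
Definition fpsD F G : fps R := Fps (fun k => coefps k F + coefps k G).
Definition fpsM F G : fps R :=
  Fps (fun k => \sum_(i < k.+1) coefps i F * coefps (k - i)%N G).
Definition fpsZ (a : R) F : fps R := Fps (fun k => a * coefps k F).

Lemma fpsDA : associative fpsD.
Proof. by move=> F G H; apply/fpsP => k; apply: addrA. Qed.
Lemma fpsDC : commutative fpsD.
Proof. by move=> F G; apply/fpsP => k; apply: addrC. Qed.
Lemma fps0D : left_id fps0 fpsD.
Proof. by move=> F; apply/fpsP => k; apply: add0r. Qed.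
Lemma fpsND : left_inverse fps0 fpsN fpsD.
Proof. by move=> F; apply/fpsP => k; apply: addNr. Qed.

HB.instance Definition _ := GRing.isZmodule.Build (fps R) fpsDA fpsDC fps0D fpsND.

Let trunc n F : {poly R} := \poly_(i < n) coefps i F.

Let coef_trunc n F i : (i < n)%N -> (trunc n F)`_i = coefps i F.
Proof. by move=> lt_in; rewrite coef_poly lt_in. Qed.

Let coefM_trunc n F G k : (k < n)%N ->
  coefps k (fpsM F G) = (trunc n F * trunc n G)`_k.
Proof.
move=> ltkn; rewrite coefM; apply: eq_bigr => i _.
by rewrite !coef_trunc // (leq_ltn_trans _ ltkn) ?leq_subr // -ltnS.
Qed.

Lemma fpsMC : commutative fpsM.
Proof.
by move=> F G; apply/fpsP => k; rewrite !(@coefM_trunc k.+1) // mulrC.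
Qed.

Lemma fpsMA : associative fpsM.
Proof.
move=> F G H; apply/fpsP => k.
transitivity ((trunc k.+1 F * (trunc k.+1 G * trunc k.+1 H))`_k).
  rewrite coefM; apply: eq_bigr => i _.
  by rewrite coef_trunc // -coefM_trunc // ltnS leq_subr.
rewrite mulrA coefM; apply: eq_bigr => i _.
by rewrite coef_trunc ?ltnS ?leq_subr // -coefM_trunc.
Qed.

Lemma fps1M : left_id fps1 fpsM.
Proof.
move=> F; apply/fpsP => k; rewrite /coefps /= big_ord_recl /= subn0 mul1r.
by rewrite big1 ?addr0 // => i _; rewrite /coefps /= mul0r.
Qed.

Lemma fpsMDl : left_distributive fpsM fpsD.
Proof.
move=> F G H; apply/fpsP => k; rewrite /coefps /= -big_split /=.
by apply: eq_bigr => i _; rewrite /coefps /= mulrDl.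
Qed.

Lemma fps1_neq0 : fps1 != 0.
Proof.
by apply/eqP => /fpsP/(_ 0); apply/eqP; rewrite /coefps /= oner_neq0.
Qed.

HB.instance Definition _ := GRing.Zmodule_isComNzRing.Build (fps R)
  fpsMA fpsMC fps1M fpsMDl fps1_neq0.

Lemma fpsZA a b F : fpsZ a (fpsZ b F) = fpsZ (a * b) F.
Proof. by apply/fpsP => k; apply: mulrA. Qed.
Lemma fps1Z : left_id 1 fpsZ.
Proof. by move=> F; apply/fpsP => k; apply: mul1r. Qed.
Lemma fpsZDr : right_distributive fpsZ +%R.
Proof. by move=> a F G; apply/fpsP => k; apply: mulrDr. Qed.
Lemma fpsZDl F : {morph fpsZ^~ F : a b / a + b}.
Proof. by move=> a b; apply/fpsP => k; apply: mulrDl. Qed.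

HB.instance Definition _ := GRing.Zmodule_isLmodule.Build R (fps R)
  fpsZA fps1Z fpsZDr fpsZDl.

Lemma fpsZAl (a : R) F G : a *: (F * G) = (a *: F) * G.
Proof.
apply/fpsP => k; rewrite /coefps /= mulr_sumr.
by apply: eq_bigr => i _; rewrite /coefps /= mulrA.
Qed.

HB.instance Definition _ := GRing.Lmodule_isLalgebra.Build R (fps R) fpsZAl.
HB.instance Definition _ := GRing.Lalgebra_isComAlgebra.Build R (fps R).

Lemma coefpsM k F G :
  coefps k (F * G) = \sum_(i < k.+1) coefps i F * coefps (k - i)%N G.
Proof. by []. Qed.

(* F ^+ m has valuation at least m when F has no constant term. *)
Lemma coefpsX_small F m k : coefps 0 F = 0 -> (k < m)%N -> coefps k (F ^+ m) = 0.
Proof.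
move=> F0; elim: m k => // m IHm k ltkm; rewrite exprS coefpsM big_ord_recl.
rewrite F0 mul0r add0r big1 // => i _; rewrite IHm ?mulr0 //= /bump /=.
by have := ltn_ord i; lia.
Qed.

End FpsRing.

(* log F = \sum_(m >= 1) (-1)^(m+1) / m (F - 1)^m, meaningful when F has      *)
(* constant term 1.  Then [y^k] (F - 1)^m = 0 for m > k, so that [y^k] log F  *)
(* only involves the terms m <= k; see coef_fps_log.                          *)
Definition fps_log (A : comAlgType rat) (F : fps A) : fps A :=
  Fps (fun k => \sum_(1 <= m < k.+1)
                  ((-1) ^+ m.+1 / m%:R : rat) *: coefps k ((F - 1) ^+ m)).

Lemma coef_fps_log (A : comAlgType rat) (F : fps A) (k N : nat) :
  coefps 0 F = 1 -> (k <= N)%N ->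
  coefps k (fps_log F) =
    \sum_(1 <= m < N.+1)
      ((-1) ^+ m.+1 / m%:R : rat) *: coefps k ((F - 1) ^+ m).
Proof.
move=> F0 lekN; rewrite [RHS](@big_cat_nat _ _ _ k.+1) //=.
set S := (X in _ = _ + X); suff -> : S = 0 by rewrite addr0.
rewrite /S big_nat big1 // => m /andP[ltkm _].
rewrite coefpsX_small ?scaler0 //.
by change (coefps 0 F - 1 = 0); rewrite F0 subrr.
Qed.

Definition is_edge_set (V : finType) (E : {set {set V}}) : bool :=
  [forall e in E, #|e| == 2].

Definition sgraph (V : finType) : Type := {E : {set {set V}} | is_edge_set E}.
HB.instance Definition _ (V : finType) := Finite.on (sgraph V).

Section Graphs.
Variable V : finType.
Implicit Type G : sgraph V.

Definition edges G : {set {set V}} := val G.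

Definition adj G : rel V := [rel u v | [set u; v] \in edges G].

Definition components G : {set {set V}} :=
  equivalence_partition (connect (adj G)) [set: V].

Definition excess_on G (C : {set V}) : int :=
  #|[set e in edges G | e \subset C]|%:Z - #|C|%:Z.

Definition excess G : int := #|edges G|%:Z - #|V|%:Z.

Lemma excess_onT G : excess_on G [set: V] = excess G.
Proof.
rewrite /excess_on /excess cardsT; congr (Posz #|pred_of_set _| - _).
by apply/setP => e; rewrite inE subsetT andbT.
Qed.

(* The graph with no vertex is not connected. *)
Definition connected_graph G : bool :=
  (0 < #|V|)%N && [forall u, forall v, connect (adj G) u v].

(* The graph with no vertex is positive, of excess 0. *)
Definition positive_graph G : bool :=
  [forall C in components G, 0 < excess_on G C].

End Graphs.

(* Members with n vertices are taken on the vertex set 'I_n, i.e. labels are  *)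
(* shifted to 0, ..., n-1.                                                    *)
Definition excess_gf (P : forall n : nat, pred (sgraph 'I_n)) (k : int) :
    fps rat :=
  Fps (fun n => \sum_(G : sgraph 'I_n | P n G && (excess G == k)) (n`!%:R)^-1).

Definition CSG (k : nat) : fps rat :=
  excess_gf (fun n => @connected_graph 'I_n) k%:Z.

Definition SGpos (l : nat) : fps rat :=
  excess_gf (fun n => @positive_graph 'I_n) l%:Z.

(* Main.v *)
From HB Require Import structures.
Require Import Defs.
From mathcomp Require Import all_boot all_order all_algebra.
From mathcomp Require Import zify ring.

(** Let [P] be the bivariate series of positive graphs and [C] the one of
connected graphs of positive excess, both with [y] marking the excess.  A graph
is positive exactly when each component is a connected graph of positive
excess, and the excess is additive over components; so [P = exp C].  The only
graph which is positive of excess 0 is the void one, which is why [P] is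
[1 + sum_(l >= 1) SGpos l y^l] and has a logarithm.

The exponential formula is proved in its differential form.  With the Euler
operator [theta = z d/dz], which marks a vertex,
  [theta P = theta C * P]
says that a positive graph with a marked vertex [v] is the component of [v],
with [v] marked, together with an arbitrary positive graph on the other
vertices ([positive_poly_rec], [positive_enum_rec], [theta_positive_series]).
On the other hand [theta (log P) * P = theta P] for every series with constant
term 1 ([map_fps_log]), whence [theta (log P) = theta C]: the two series agree
on every [z^n] with [n > 0].  The constant terms in [z] vanish on both sides:
the void graph is not connected, and [P - 1] has no [z^0] term.

To decompose graphs without changing the ambient vertex type, a graph is a
pair of a vertex set [S] and a set [E] of pairs inside [S]; that the counts
depend only on [#|S|] comes from transport along injections. *)

Set Implicit Arguments.
Unset Strict Implicit.
Unset Printing Implicit Defensive.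

Import GRing.Theory Num.Theory.
Local Open Scope ring_scope.

(** * Logarithmic derivatives of formal power series *)

Lemma coefps_is_linear (R : comNzRingType) k : linear_for *%R (@coefps R k).
Proof. by []. Qed.

HB.instance Definition _ (R : comNzRingType) k :=
  GRing.isLinear.Build R (fps R) R *%R (@coefps R k) (@coefps_is_linear R k).

Arguments coefps : simpl never.

Lemma coefps1 (R : comNzRingType) k : coefps k (1 : fps R) = (k == 0)%:R.
Proof. by []. Qed.

Lemma coefps0M (R : comNzRingType) (F G : fps R) :
  coefps 0 (F * G) = coefps 0 F * coefps 0 G.
Proof. by rewrite coefpsM big_ord1. Qed.

(** The constant term 1 makes the system of equations for the coefficients of
a quotient triangular. *)
Lemma fps_mulIr (R : comNzRingType) (F : fps R) :
  coefps 0 F = 1 -> injective ( *%R^~ F).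
Proof.
move=> F0 G H /eqP; rewrite -subr_eq0 -mulrBl => /eqP GHF.
apply/eqP; rewrite -subr_eq0; apply/eqP; move: (G - H) GHF => K KF {G H}.
apply/fpsP; elim/ltn_ind=> k IHk.
have /fpsP/(_ k) := KF; rewrite coefpsM big_ord_recr /= subnn F0 mulr1.
by rewrite big1 ?add0r // => i _; rewrite IHk ?mul0r.
Qed.

(** A derivation [d] of the coefficient ring acts on series coefficient by
coefficient; here it will be [theta], acting on series in [y] whose
coefficients are series in [z]. *)
Section CoefficientwiseDerivation.
Variables (A : comAlgType rat) (d : {linear A -> A}).
Hypothesis dM : forall a b, d (a * b) = d a * b + a * d b.

Definition map_fps (F : fps A) : fps A := Fps (fun k => d (coefps k F)).

Lemma coef_map_fps k F : coefps k (map_fps F) = d (coefps k F).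
Proof. by []. Qed.

Lemma map_fps_is_zmod_morphism : zmod_morphism map_fps.
Proof. by move=> F G; apply/fpsP => k; rewrite !(raddfB, coef_map_fps). Qed.

HB.instance Definition _ :=
  GRing.isZmodMorphism.Build (fps A) (fps A) map_fps map_fps_is_zmod_morphism.

Lemma map_fpsM F G :
  map_fps (F * G) = map_fps F * G + F * map_fps G.
Proof.
apply/fpsP => k; rewrite raddfD coef_map_fps !coefpsM raddf_sum -big_split.
by apply: eq_bigr => i _; rewrite /= dM.
Qed.

Lemma map_fpsZ (a : rat) F :
  map_fps (a%:A *: F) = a%:A *: map_fps F.
Proof.
apply/fpsP => k; rewrite linearZ /= !coef_map_fps linearZ /=.
by rewrite -!scalerAl !mul1r linearZ.
Qed.

Lemma map_fpsX F m : map_fps (F ^+ m.+1) = F ^+ m * map_fps F *+ m.+1.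
Proof.
elim: m => [|m IHm]; first by rewrite expr1 mul1r.
by rewrite exprS map_fpsM IHm mulrnAr mulrA -exprS [RHS]mulrS mulrC.
Qed.

Lemma map_fps1 : map_fps 1 = 0.
Proof.
have := map_fpsX 1 1; rewrite expr1n mul1r mulr2n => /eqP.
by rewrite -subr_eq0 opprD addrA subrr sub0r oppr_eq0 => /eqP.
Qed.

(** Up to any given degree, [log F] is a polynomial in [Q = F - 1], whose
derivative is [d Q] times a partial sum of the geometric series [1 / (1 + Q)];
the remainder [(- Q) ^+ k.+1] has no coefficient of degree [k] or less. *)
Lemma map_fps_log F : coefps 0 F = 1 ->
  map_fps (fps_log F) * F = map_fps F.
Proof.
move=> F0; apply/fpsP => k; set Q := F - 1.
have Q0 : coefps 0 Q = 0 by rewrite raddfB /= F0 subrr.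
pose L := \sum_(m < k.+1) ((-1) ^+ m.+2 / m.+1%:R : rat)%:A *: Q ^+ m.+1.
have dL : map_fps L = map_fps F * \sum_(m < k.+1) (- Q) ^+ m.
  rewrite raddf_sum mulr_sumr; apply: eq_bigr => m _.
  rewrite /= map_fpsZ map_fpsX /Q raddfB /= map_fps1 subr0.
  rewrite -scaler_nat scalerA -scaler_nat -scalerAl mul1r scalerA.
  rewrite divfK ?pnatr_eq0 // !exprS !mulN1r opprK.
  rewrite [in RHS]mulrC [in RHS]exprNn -mulrA -!(signr_odd _ m).
  by case: (odd m); rewrite ?expr1 ?expr0 ?scaleN1r ?scale1r ?mulN1r ?mul1r.
transitivity (coefps k (map_fps L * F)).
  rewrite !coefpsM; apply: eq_bigr => -[i /= lt_ik] _; congr (_ * _).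
  rewrite !coef_map_fps (@coef_fps_log _ _ _ k.+1) // 1?ltnW //.
  rewrite big_add1 big_mkord; apply: (congr1 d); rewrite raddf_sum.
  by apply: eq_bigr => m _; rewrite /= linearZ /= -scalerAl mul1r.
have geom (X : fps A) : (\sum_(m < k.+1) X ^+ m) * (1 - X) = 1 - X ^+ k.+1.
  by rewrite -[RHS]opprB subrX1 -mulNr opprB mulrC.
have defF : F = 1 - (- Q) by rewrite opprK /Q addrC subrK.
have {}geom := geom (- Q); rewrite -defF in geom.
rewrite dL -mulrA geom mulrBr mulr1 raddfB /= coefpsM big1 ?subr0 // => i _.
by rewrite coefpsX_small ?mulr0 ?raddfN /= ?Q0 ?oppr0 // ltnS leq_subr.
Qed.

End CoefficientwiseDerivation.

(** The Euler operator [z d/dz]: on an exponential generating function it marks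
one vertex, and unlike [d/dz] it does not shift the coefficients. *)
Definition theta (R : comNzRingType) (f : fps R) : fps R :=
  Fps (fun n => n%:R * coefps n f).

Lemma coef_theta (R : comNzRingType) n (f : fps R) :
  coefps n (theta f) = n%:R * coefps n f.
Proof. by []. Qed.

Lemma theta_is_linear (R : comNzRingType) : linear (@theta R).
Proof.
move=> a f g; apply/fpsP => n.
change (n%:R * (a * coefs f n + coefs g n) =
        a * (n%:R * coefs f n) + n%:R * coefs g n).
ring.
Qed.
HB.instance Definition _ (R : comNzRingType) :=
  GRing.isLinear.Build R (fps R) (fps R) *:%R (@theta R) (@theta_is_linear R).

Lemma thetaM (R : comNzRingType) (f g : fps R) :
  theta (f * g) = theta f * g + f * theta g.
Proof.
apply/fpsP => n; rewrite raddfD /= coef_theta !coefpsM mulr_sumr -big_split.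
apply: eq_bigr => -[i /= lt_in] _; rewrite !coef_theta.
by rewrite -{1}(subnKC (m := i) (n := n)) // natrD; ring.
Qed.

(** * Graphs on a subset of the vertices *)

Lemma connect_ind (T : finType) (e : rel T) (P : T -> Prop) x y :
  (forall a b, P a -> e a b -> P b) -> P x -> connect e x y -> P y.
Proof.
move=> Pe Px /connectP[p ep ->].
elim: p x Px ep => //= z p IHp x Px /andP[exz ep].
exact: (IHp z) (Pe _ _ Px exz) ep.
Qed.

Section EdgeSets.
Variable V : finType.
Implicit Types (S T C e : {set V}) (E : {set {set V}}).

Definition edge_rel E : rel V := [rel u v | [set u; v] \in E].
Definition graph_on S E := [forall e in E, (#|e| == 2) && (e \subset S)].
Definition connected_on S E :=
  (S != set0) && [forall u in S, forall v in S, connect (edge_rel E) u v].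
Definition component S E x := [set y in S | connect (edge_rel E) x y].
Definition inner E C := [set e in E | e \subset C].
Definition positive_on S E :=
  [forall x in S, #|component S E x| < #|inner E (component S E x)|]%N.

Lemma graph_onP S E :
  reflect (forall e, e \in E -> #|e| = 2 /\ e \subset S) (graph_on S E).
Proof.
apply: (iffP forall_inP) => [gE e /gE/andP[/eqP] | gE e /gE[-> ->]] //.
Qed.

Lemma inner_graph S C E : graph_on S E -> graph_on C (inner E C).
Proof.
move=> /graph_onP gE; apply/graph_onP => e; rewrite inE => /andP[eE ->].
by have [-> _] := gE e eE.
Qed.

Lemma connect_edge_sym E : connect_sym (edge_rel E).
Proof. by apply: sym_connect_sym => u v; rewrite /edge_rel /= setUC. Qed.

Lemma graph_on_edge_rel S E a b :
  graph_on S E -> edge_rel E a b -> (a \in S) && (b \in S).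
Proof. by move=> /graph_onP gE /gE[_]; rewrite subUset !sub1set. Qed.

(** Every component has at least one more edge than vertices, and no edge lies
inside two of them.  Hence positive graphs have nonnegative excess, and excess 0
forces the absence of components. *)
Lemma positive_card S E : graph_on S E -> positive_on S E ->
  (#|S| + #|component S E @: S| <= #|E|)%N.
Proof.
move=> gE pE; set P := component S E @: S.
have partP : partition P S.
  apply: equivalence_partitionP => x y z _ _ _; split=> // cxy.
  by rewrite (same_connect (connect_edge_sym E) cxy).
rewrite (card_partition partP) -sum1_card -big_split /=.
apply: (@leq_trans (\sum_(C in P) #|inner E C|)%N).
  apply: leq_sum => C /imsetP[x xS ->]; rewrite addn1.
  exact: (forall_inP pE).
have -> : (\sum_(C in P) #|inner E C| =
           \sum_(e in E) #|[set C in P | e \subset C]|)%N.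
  under eq_bigr do rewrite -sum1_card.
  under [RHS]eq_bigr do rewrite -sum1_card.
  rewrite (exchange_big_dep (mem E)) /=; last first.
    by move=> C e _; rewrite inE => /andP[].
  apply: eq_bigr => e eE; apply: eq_bigl => C.
  by rewrite !inE eE.
rewrite -[leqRHS]sum1_card; apply: leq_sum => e eE.
have [/eqP/cards2P[a [b [_ ->]]] _] := graph_onP _ _ gE e eE.
apply/card_le1_eqP => C D; rewrite !inE !subUset !sub1set.
move=> /andP[CP /andP[aC _]] /andP[DP /andP[aD _]].
have /and3P[_ /trivIsetP tP _] := partP.
apply: contraPeq aD => CD; have /tP := CD.
by move=> /(_ DP CP)/disjointFl ->.
Qed.

(** Two graphs on disjoint vertex sets do not interact: this is what makes the
splitting off of a component reversible. *)
Section Union.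
Variables (T T' : {set V}) (E E' : {set {set V}}).
Hypotheses (TT' : [disjoint T & T']) (gE : graph_on T E) (gE' : graph_on T' E').

Lemma graph_onU : graph_on (T :|: T') (E :|: E').
Proof.
apply/graph_onP => e /setUP[/(graph_onP _ _ gE)|/(graph_onP _ _ gE')] [-> eT].
  by rewrite (subset_trans eT) ?subsetUl.
by rewrite (subset_trans eT) ?subsetUr.
Qed.

Lemma connectU u w : u \in T ->
  connect (edge_rel (E :|: E')) u w = (w \in T) && connect (edge_rel E) u w.
Proof.
move=> uT; apply/idP/andP; last first.
  case=> _; apply: connect_sub => a b ab; apply: connect1.
  by rewrite /edge_rel /= inE; apply/orP; left.
apply: (connect_ind (P := fun w => w \in T /\ connect (edge_rel E) u w)) => //.
move=> a b [aT ua].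
rewrite /edge_rel /= inE => /orP[abE|].
  have /andP[_ bT] := graph_on_edge_rel gE abE.
  by split=> //; apply: connect_trans ua _; apply: connect1.
move=> /(graph_on_edge_rel gE')/andP[aT' _].
by have := disjointFr TT' aT; rewrite aT'.
Qed.

Lemma componentU x : x \in T ->
  component (T :|: T') (E :|: E') x = component T E x.
Proof.
move=> xT; apply/setP => y; rewrite !inE connectU //.
by case: (y \in T); rewrite ?andbF.
Qed.

Lemma innerU C : C \subset T -> inner (E :|: E') C = inner E C.
Proof.
move=> CT; apply/setP => e; rewrite !inE andb_orl.
case eE': (e \in E'); rewrite ?orbF // orb_idr //= => eC.
have [/eqP/cards2P[a [b [_ def_e]]]] := graph_onP _ _ gE' e eE'.
move: eC; rewrite def_e !subUset !sub1set => /andP[aC _] /andP[aT' _].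
by have := disjointFr TT' (subsetP CT a aC); rewrite aT'.
Qed.

Lemma disjoint_edges : [disjoint E & E'].
Proof.
rewrite disjoint_subset; apply/subsetP => e eE; rewrite inE; apply/negP => eE'.
have [/eqP/cards2P[a [b [_ def_e]]] _] := graph_onP _ _ gE e eE.
have [_] := graph_onP _ _ gE' e eE'; have [_] := graph_onP _ _ gE e eE.
rewrite def_e !subUset !sub1set => /andP[aT _] /andP[aT' _].
by have := disjointFr TT' aT; rewrite aT'.
Qed.

Lemma inner_id : inner E T = E.
Proof.
by apply/setP => e; rewrite inE andb_idr // => /(graph_onP _ _ gE)[].
Qed.

End Union.

Lemma component_sub S E x : component S E x \subset S.
Proof. by apply/subsetP => y; rewrite inE => /andP[]. Qed.

Lemma positive_onU T T' E E' :
  [disjoint T & T'] -> graph_on T E -> graph_on T' E' ->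
  positive_on (T :|: T') (E :|: E') = positive_on T E && positive_on T' E'.
Proof.
move=> TT' gE gE'; have T'T : [disjoint T' & T] by rewrite disjoint_sym.
have l x : x \in T -> component (T :|: T') (E :|: E') x = component T E x.
  exact: componentU.
have r x : x \in T' -> component (T :|: T') (E :|: E') x = component T' E' x.
  by rewrite setUC [E :|: _]setUC; exact: componentU.
apply/forall_inP/andP => [pU | [/forall_inP pE /forall_inP pE'] x].
  split; apply/forall_inP => x xT;
    have := pU x; rewrite inE xT ?orbT => /(_ isT).
    by rewrite l // (innerU _ TT') // component_sub.
  by rewrite r // setUC (innerU _ T'T) // component_sub.
case/setUP=> xT; first by rewrite l // (innerU _ TT') ?pE // component_sub.
by rewrite r // setUC (innerU _ T'T) ?pE' // component_sub.
Qed.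

Lemma connected_onE T E v : v \in T ->
  connected_on T E = (component T E v == T).
Proof.
move=> vT; have T0 : T != set0 by apply/set0Pn; exists v.
rewrite /connected_on T0 /=; apply/idP/eqP => [/forall_inP cT | cT].
  apply/setP => y; rewrite inE andb_idr // => yT.
  exact: (forall_inP (cT _ vT)).
have vc y : y \in T -> connect (edge_rel E) v y.
  by rewrite -{1}cT inE => /andP[].
apply/forall_inP => a aT; apply/forall_inP => b bT.
by apply: connect_trans (vc b bT); rewrite connect_edge_sym vc.
Qed.

(** On a connected graph, positivity means positive excess. The truncated
subtraction in the exponents is harmless, by [positive_card]. *)
Definition connected_poly S : {poly rat} :=
  \sum_(E | [&& graph_on S E, connected_on S E & positive_on S E])
     'X^(#|E| - #|S|).
Definition positive_poly S : {poly rat} :=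
  \sum_(E | graph_on S E && positive_on S E) 'X^(#|E| - #|S|).

(** A graph is determined by the component [T] of [v] and by its restriction to
the complement of [T]. Any two graphs on these sets can be put side by side,
and the exponents add up because both graphs have nonnegative excess. *)
Lemma positive_poly_rec S v : v \in S ->
  positive_poly S = \sum_(T : {set V} | (v \in T) && (T \subset S))
                      connected_poly T * positive_poly (S :\: T).
Proof.
move=> vS.
rewrite /positive_poly (partition_big (fun E => component S E v)
  (fun T : {set V} => (v \in T) && (T \subset S))) /=; last first.
  by move=> E _; rewrite component_sub inE vS connect0.
apply: eq_bigr => T /andP[vT TS].
set T' := S :\: T.
have ST : S = T :|: T' by rewrite -[LHS](setID S T) (setIidPr TS).
have TT' : [disjoint T & T'].
  by rewrite disjoint_subset; apply/subsetP => x xT; rewrite !inE xT.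
have T'T : [disjoint T' & T] by rewrite disjoint_sym.
rewrite big_distrlr /= pair_big /=.
rewrite (reindex_onto (fun p => p.1 :|: p.2)
                      (fun E => (inner E T, inner E T'))).
  (* The last conjunct on the left says that no edge of [E] or [E'] leaves [T],
     respectively [T']: only such pairs arise from the decomposition. *)
  have splitE E E' : [&& graph_on S (E :|: E'), positive_on S (E :|: E'),
      component S (E :|: E') v == T &
      (inner (E :|: E') T, inner (E :|: E') T') == (E, E')] =
    [&& graph_on T E, connected_on T E & positive_on T E] &&
    (graph_on T' E' && positive_on T' E').
    apply/idP/idP => [/and4P[gU pU cU /eqP[defE defE']] |].
      have gE : graph_on T E by rewrite -defE; apply: inner_graph gU.
      have gE' : graph_on T' E' by rewrite -defE'; apply: inner_graph gU.
      move: pU cU; rewrite ST positive_onU // => /andP[-> ->].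
      by rewrite (componentU TT') // -connected_onE // gE gE' => ->.
    case/andP=> /and3P[gE cE pE] /andP[gE' pE'].
    rewrite ST (graph_onU gE gE') (positive_onU TT') // pE pE'.
    rewrite (componentU TT') // -connected_onE // cE /= (innerU _ TT') //.
    by rewrite [E :|: _]setUC (innerU _ T'T) // !inner_id.
  apply: eq_big => [[E E'] | [E E']] /=; first by rewrite -splitE -!andbA.
  rewrite -!andbA splitE => /andP[/and3P[gE _ pE] /andP[gE' pE']].
  have cardU (W : finType) (B C : {set W}) :
      [disjoint B & C] -> #|B :|: C| = (#|B| + #|C|)%N.
    by move=> BC; apply/eqP; rewrite (leq_card_setU B C).2.
  have subnD (a b c d : nat) : (c <= a)%N -> (d <= b)%N ->
    (a + b - (c + d) = (a - c) + (b - d))%N by lia.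
  rewrite ST !cardU ?(disjoint_edges TT' gE gE') // -exprD subnD //.
    exact: leq_trans (leq_addr _ _) (positive_card gE pE).
  exact: leq_trans (leq_addr _ _) (positive_card gE' pE').
(* No edge joins [T] to its complement: the two parts cover [E]. *)
move=> E /andP[/andP[gE pE] /eqP cE] /=.
apply/setP => e; rewrite !inE -andb_orr andb_idr // => eE.
have [/eqP/cards2P[a [b [ab def_e]]] eS] := graph_onP _ _ gE e eE.
have adj_ab : connect (edge_rel E) a b.
  by apply: connect1; rewrite /edge_rel /= -def_e.
move: eS; rewrite def_e !subUset !sub1set => /andP[aS bS].
rewrite !(inE, aS, bS) -cE !inE aS bS /= !andbT.
suff -> : connect (edge_rel E) v a = connect (edge_rel E) v b.
  by rewrite !andbb orbN.
by rewrite (same_connect_r (connect_edge_sym E) adj_ab).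
Qed.
End EdgeSets.

(** * Relabelling *)

Section Relabelling.
Variables (V W : finType) (f : V -> W).
Hypothesis injf : injective f.
Implicit Types (S T C e : {set V}) (E : {set {set V}}).

Definition map_edges E : {set {set W}} := [set f @: (e : {set V}) | e in E].

Lemma mem_map_edges E e : (f @: e \in map_edges E) = (e \in E).
Proof. exact: mem_imset (imset_inj injf). Qed.

Lemma edge_rel_map E u w : edge_rel (map_edges E) (f u) (f w) = edge_rel E u w.
Proof. by rewrite /edge_rel /= -(mem_map_edges E) imsetU1 imset_set1. Qed.

Lemma imset_subset (A B : {set V}) : (f @: A \subset f @: B) = (A \subset B).
Proof.
apply/idP/idP => [/subsetP sAB | ]; last exact: imsetS.
by apply/subsetP => x xA; rewrite -(mem_imset _ _ injf) sAB ?imset_f.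
Qed.

Lemma connect_map E u w :
  connect (edge_rel (map_edges E)) (f u) (f w) = connect (edge_rel E) u w.
Proof.
apply/idP/idP => [cuw |].
  have: exists2 w', f w = f w' & connect (edge_rel E) u w'.
    (* A path that starts in the image of [f] stays in it. *)
    pose P y := exists2 w', y = f w' & connect (edge_rel E) u w'.
    apply: (connect_ind (P := P)) cuw.
      move=> _ b [a -> ua] /imsetP[e eE def_e].
      have: b \in f @: e by rewrite -def_e set22.
      case/imsetP=> b' b'e def_b; exists b' => //.
      apply: connect_trans ua (connect1 _).
      by rewrite -edge_rel_map -def_b /edge_rel /= def_e mem_map_edges.
    by exists u.
  by case=> w' /injf ->.
pose P w := connect (edge_rel (map_edges E)) (f u) (f w).
apply: (connect_ind (P := P)) => [a b ua ab|]; last exact: connect0.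
by apply: connect_trans ua (connect1 _); rewrite edge_rel_map.
Qed.

Lemma graph_on_map S E : graph_on (f @: S) (map_edges E) = graph_on S E.
Proof.
apply/graph_onP/graph_onP => gE e eE.
  have := gE (f @: e).
  by rewrite mem_map_edges card_imset // imset_subset; apply.
by case/imsetP: eE => e' /gE[e'2 e'S] ->; rewrite card_imset // imset_subset.
Qed.

Lemma connected_on_map S E :
  connected_on (f @: S) (map_edges E) = connected_on S E.
Proof.
rewrite /connected_on imset_eq0; congr (_ && _).
apply/forall_inP/forall_inP => cE u uS.
  apply/forall_inP => w wS; rewrite -connect_map.
  by apply: (forall_inP (cE _ _)); apply: imset_f.
case/imsetP: uS => u' /cE/forall_inP cu' ->.
by apply/forall_inP => _ /imsetP[w' /cu' ? ->]; rewrite connect_map.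
Qed.

Lemma component_map S E x :
  component (f @: S) (map_edges E) (f x) = f @: component S E x.
Proof.
apply/setP => y; rewrite inE; apply/andP/imsetP => [[/imsetP[z zS ->]] | [z]].
  by rewrite connect_map => xz; exists z; rewrite // inE zS.
by rewrite inE => /andP[zS xz] ->; rewrite connect_map imset_f.
Qed.

Lemma inner_map E C : inner (map_edges E) (f @: C) = map_edges (inner E C).
Proof.
apply/setP => e; rewrite inE.
apply/andP/imsetP => [[/imsetP[e' e'E ->]] | [e']].
  by rewrite imset_subset => ?; exists e'; rewrite // inE e'E.
by rewrite inE => /andP[e'E e'C] ->; rewrite imset_subset mem_map_edges.
Qed.

Lemma card_map_edges E : #|map_edges E| = #|E|.
Proof. exact: card_imset (imset_inj injf). Qed.

Lemma positive_on_map S E :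
  positive_on (f @: S) (map_edges E) = positive_on S E.
Proof.
have eqp x : (#|component (f @: S) (map_edges E) (f x)| <
  #|inner (map_edges E) (component (f @: S) (map_edges E) (f x))|)%N =
  (#|component S E x| < #|inner E (component S E x)|)%N.
  by rewrite component_map inner_map card_map_edges card_imset.
apply/forall_inP/forall_inP => pE x xS.
  by rewrite -eqp; apply/pE/imset_f.
by case/imsetP: xS => x' x'S ->; rewrite eqp pE.
Qed.

Lemma sum_map_edges (R : nmodType) S (P : pred {set {set W}})
    (F : {set {set W}} -> R) :
  \sum_(E | graph_on (f @: S) E && P E) F E =
  \sum_(E | graph_on S E && P (map_edges E)) F (map_edges E).
Proof.
rewrite (reindex_onto map_edges (fun E' : {set {set W}} =>
                                   [set e : {set V} | f @: e \in E'])) /=.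
  apply: eq_bigl => E; rewrite graph_on_map; apply: andb_idr => _.
  by apply/eqP/setP => e; rewrite inE mem_map_edges.
move=> E /andP[gE _]; apply/setP => e; apply/imsetP/idP => [[e'] | eE].
  by rewrite inE => ? ->.
have [_ eS] := graph_onP _ _ gE e eE.
suff ef : f @: (f @^-1: e) = e by exists (f @^-1: e); rewrite ?inE ef.
apply/setP => y; apply/imsetP/idP => [[x] | ye]; first by rewrite inE => ? ->.
have /imsetP[x _ def_y] := subsetP eS y ye.
by exists x; rewrite // inE -def_y.
Qed.

Lemma positive_poly_map S : positive_poly (f @: S) = positive_poly S.
Proof.
rewrite /positive_poly sum_map_edges; apply: eq_big => E.
  by rewrite positive_on_map.
by rewrite card_map_edges card_imset.
Qed.

Lemma connected_poly_map S : connected_poly (f @: S) = connected_poly S.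
Proof.
rewrite /connected_poly sum_map_edges; apply: eq_big => E.
  by rewrite positive_on_map connected_on_map.
by rewrite card_map_edges card_imset.
Qed.
End Relabelling.

Definition positive_enum n := positive_poly [set: 'I_n].
Definition connected_enum n := connected_poly [set: 'I_n].

Lemma positive_poly_card (V : finType) (S : {set V}) :
  positive_poly S = positive_enum #|S|.
Proof.
rewrite /positive_enum -(positive_poly_map (@enum_val_inj _ (mem S))).
congr (positive_poly _).
apply/setP => x; apply/idP/imsetP => [xS | [i _ ->]]; last exact: enum_valP.
by exists (enum_rank_in xS x); rewrite ?enum_rankK_in.
Qed.

Lemma connected_poly_card (V : finType) (S : {set V}) :
  connected_poly S = connected_enum #|S|.
Proof.
rewrite /connected_enum -(connected_poly_map (@enum_val_inj _ (mem S))).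
congr (connected_poly _).
apply/setP => x; apply/idP/imsetP => [xS | [i _ ->]]; last exact: enum_valP.
by exists (enum_rank_in xS x); rewrite ?enum_rankK_in.
Qed.

(** This is [positive_poly_rec] summed over all vertices [v]: a component with
[k] vertices is found from each of them, and there are ['C(n, k)] choices of
its vertices. *)
Lemma positive_enum_rec n : positive_enum n *+ n =
  \sum_(k < n.+1) connected_enum k * positive_enum (n - k) *+ (k * 'C(n, k)).
Proof.
transitivity (\sum_(v < n) positive_enum n).
  by rewrite sumr_const card_ord.
under eq_bigr => v _ do
  rewrite /positive_enum (@positive_poly_rec _ _ v) ?inE //.
rewrite (exchange_big_dep predT) //=.
transitivity (\sum_(T : {set 'I_n})
                connected_enum #|T| * positive_enum (n - #|T|) *+ #|T|).
  apply: eq_bigr => T _; rewrite (eq_bigl (mem T)) => [|v]; last first.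
    by rewrite subsetT andbT.
  rewrite sumr_const connected_poly_card positive_poly_card setTD.
  by rewrite [#|~: T|]cardsCs setCK card_ord.
rewrite (partition_big (fun T : {set 'I_n} => inord #|T| : 'I_n.+1) predT) //=.
apply: eq_bigr => k _.
rewrite (eq_bigl (mem [set T : {set 'I_n} | #|T| == k])) => [|T]; last first.
  by rewrite !inE -val_eqE /= inordK // ltnS -[leqRHS]card_ord max_card.
rewrite (eq_bigr (fun=> connected_enum k * positive_enum (n - k) *+ k)).
  by rewrite sumr_const card_draws card_ord mulrnA.
by move=> T; rewrite !inE => /eqP ->.
Qed.

(** * Generating functions *)

Lemma is_edge_setE (V : finType) (E : {set {set V}}) :
  is_edge_set E = graph_on [set: V] E.
Proof. by apply: eq_forallb => e; rewrite subsetT andbT. Qed.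

Lemma sum_sgraph (R : nmodType) (V : finType) (P : pred {set {set V}})
    (F : {set {set V}} -> R) :
  \sum_(G : sgraph V | P (edges G)) F (edges G) =
  \sum_(E | graph_on [set: V] E && P E) F E.
Proof.
rewrite [RHS](@reindex_omap _ _ _ _ (sgraph V) val insub) => [|E /andP[gE _]].
  apply: eq_bigl => -[E gE] /=; rewrite -is_edge_setE gE insubT eqxx andbT.
  by rewrite /edges.
by rewrite insubT // is_edge_setE.
Qed.

Lemma positive_graphE (V : finType) (G : sgraph V) :
  positive_graph G = positive_on [set: V] (edges G).
Proof.
rewrite /positive_graph /components; apply/forall_inP/forall_inP => pG.
  move=> x xT; have := pG _ (imset_f (component [set: V] (edges G)) xT).
  by rewrite subr_gt0.
by move=> C /imsetP[x xT ->]; rewrite subr_gt0; exact: pG x xT.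
Qed.

Lemma connected_graphE (V : finType) (G : sgraph V) :
  connected_graph G = connected_on [set: V] (edges G).
Proof.
rewrite /connected_graph /connected_on -card_gt0 cardsT; congr (_ && _).
apply/'forall_forallP/'forall_in_forall_inP => cG u.
  by move=> _ v _; exact: cG.
by move=> v; apply: cG.
Qed.

Lemma connected_positiveE (V : finType) (S : {set V}) (E : {set {set V}}) :
  graph_on S E -> connected_on S E -> positive_on S E = (#|S| < #|E|)%N.
Proof.
move=> gE cE; have cmp x : x \in S -> component S E x = S.
  by move=> xS; apply/eqP; rewrite -connected_onE.
have inE' : inner E S = E by apply: inner_id.
have /andP[/set0Pn[x xS] _] := cE.
apply/forall_inP/idP => [/(_ x xS)|ltSE y yS]; first by rewrite cmp // inE'.
by rewrite cmp // inE'.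
Qed.

Lemma coef_SGpos l n : coefps n (SGpos l) = (positive_enum n)`_l / n`!%:R.
Proof.
rewrite /positive_enum /positive_poly coef_sum mulr_suml.
rewrite /SGpos /excess_gf /coefps /=.
rewrite (eq_bigl (fun G : sgraph 'I_n => positive_on [set: 'I_n] (edges G) &&
   (#|edges G| == n + l)%N)) => [|G]; last first.
  rewrite positive_graphE /excess card_ord; congr andb.
  by rewrite subr_eq -PoszD eqz_nat addnC.
rewrite (sum_sgraph
  (fun E => positive_on [set: 'I_n] E && (#|E| == n + l)%N)
  (fun=> (n`!%:R)^-1)).
under [LHS]eq_bigl do rewrite andbA.
rewrite big_mkcondr /=; apply: eq_bigr => E /andP[gE pE].
have leE : (n <= #|E|)%N.
  have := leq_trans (leq_addr _ _) (positive_card gE pE).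
  by rewrite cardsT card_ord.
rewrite coefXn cardsT card_ord; case: eqP => [->|neq].
  by rewrite addKn eqxx mul1r.
by case: eqP => [eql|]; [case: neq; rewrite eql subnKC | rewrite mul0r].
Qed.

Lemma coef_CSG k n : (0 < k)%N ->
  coefps n (CSG k) = (connected_enum n)`_k / n`!%:R.
Proof.
move=> k_gt0; rewrite /connected_enum /connected_poly coef_sum mulr_suml.
rewrite /CSG /excess_gf /coefps /=.
rewrite (eq_bigl (fun G : sgraph 'I_n => connected_on [set: 'I_n] (edges G) &&
   (#|edges G| == n + k)%N)) => [|G]; last first.
  rewrite connected_graphE /excess card_ord; congr andb.
  by rewrite subr_eq -PoszD eqz_nat addnC.
rewrite (sum_sgraph
  (fun E => connected_on [set: 'I_n] E && (#|E| == n + k)%N)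
  (fun=> (n`!%:R)^-1)).
under [LHS]eq_bigl do rewrite andbA.
under [RHS]eq_bigl do rewrite andbA.
rewrite big_mkcondr /= [RHS]big_mkcondr /=; apply: eq_bigr => E /andP[gE cE].
rewrite connected_positiveE // cardsT card_ord coefXn.
case: eqP => [->|neq].
  by rewrite addKn eqxx -[ltnLHS]addn0 ltn_add2l k_gt0 mul1r.
case: ifP => // ltnE; case: eqP => [eqk|]; last by rewrite mul0r.
by case: neq; rewrite eqk subnKC // ltnW.
Qed.

Lemma connected_enum_coef0 n : (connected_enum n)`_0 = 0.
Proof.
rewrite coef_sum big1 // => E /and3P[gE cE].
rewrite connected_positiveE // => ltE.
by rewrite coefXn eq_sym subn_eq0 leqNgt ltE.
Qed.

Lemma connected_enum_void : connected_enum 0 = 0.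
Proof.
rewrite /connected_enum /connected_poly big1 // => E.
by move=> /and3P[_ /andP[/set0Pn[[]]]].
Qed.

Lemma positive_enum_void : positive_enum 0 = 1.
Proof.
rewrite /positive_enum /positive_poly (bigD1 set0) /=; last first.
  by apply/andP; split; apply/forall_inP; [move=> e; rewrite inE | case].
rewrite big1 ?addr0 => [|E /andP[/andP[/graph_onP gE _] E0]].
  by rewrite cards0 sub0n expr0.
have /set0Pn[e /gE[e2 _]] := E0.
by have := max_card (mem e); rewrite e2 card_ord.
Qed.

Lemma positive_enum_coef0 n : (positive_enum n)`_0 = (n == 0)%:R.
Proof.
case: n => [|n]; first by rewrite positive_enum_void coefC.
rewrite coef_sum big1 // => E /andP[gE pE].
rewrite coefXn eq_sym subn_eq0 leqNgt.
suff -> : (#|[set: 'I_n.+1]| < #|E|)%N by [].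
apply: leq_trans (positive_card gE pE); rewrite -[ltnLHS]addn0 ltn_add2l.
by apply/card_gt0P; exists (component [set: 'I_n.+1] E ord0); apply: imset_f.
Qed.

Definition positive_series : fps (fps rat) :=
  1 + Fps (fun l => if (0 < l)%N then SGpos l else 0).

Definition connected_series : fps (fps rat) :=
  Fps (fun l => if (0 < l)%N then CSG l else 0).

Lemma coef_positive_series l n :
  coefps n (coefps l positive_series) = (positive_enum n)`_l / n`!%:R.
Proof.
have -> : coefps l positive_series =
  (l == 0)%:R + (if (0 < l)%N then SGpos l else 0) by [].
case: l => [|l] /=; last by rewrite add0r coef_SGpos.
rewrite addr0 positive_enum_coef0; case: n => [|n]; last by rewrite mul0r.
by rewrite divr1.
Qed.

Lemma coef_connected_series l n :
  coefps n (coefps l connected_series) = (connected_enum n)`_l / n`!%:R.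
Proof.
rewrite [coefps l connected_series]/coefps /=.
case: l => [|l] /=; last exact: coef_CSG.
by rewrite connected_enum_coef0 mul0r raddf0.
Qed.

(** The binomial coefficient in [positive_enum_rec] turns into the product of
exponential generating functions. *)
Lemma theta_positive_series :
  map_fps (@theta rat) positive_series =
  map_fps (@theta rat) connected_series * positive_series.
Proof.
apply/fpsP => l; apply/fpsP => n.
rewrite coef_map_fps coef_theta coef_positive_series mulrA mulr_natl -coefMn.
rewrite positive_enum_rec coef_sum coefpsM raddf_sum /=.
under [RHS]eq_bigr => i _ do rewrite coefpsM coef_map_fps.
rewrite exchange_big mulr_suml; apply: eq_bigr => -[k /= lekn] _.
rewrite coefMn coefM -[X in X / _]mulr_natl mulr_sumr mulr_suml.
apply: eq_bigr => i _; rewrite coef_theta.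
rewrite coef_connected_series coef_positive_series.
have /(congr1 (fun m => m%:R : rat)) := bin_fact (lekn : k <= n)%N.
rewrite !natrM => <-.
have f0 m : m`!%:R != 0 :> rat by rewrite pnatr_eq0 -lt0n fact_gt0.
have b0 : 'C(n, k)%:R != 0 :> rat by rewrite pnatr_eq0 -lt0n bin_gt0.
by field; rewrite !f0 b0.
Qed.

Lemma coefps0_exp (R : comNzRingType) (F : fps (fps R)) m l :
  (forall k, coefps 0 (coefps k F) = 0) -> coefps 0 (coefps l (F ^+ m.+1)) = 0.
Proof.
move=> F0; rewrite exprS coefpsM raddf_sum big1 // => i _.
by rewrite /= coefps0M F0 mul0r.
Qed.

Theorem proposition7 (k : nat) (hk : (0 < k)%N) :
  CSG k =
  coefps k (fps_log (1 + Fps (fun l => if (0 < l)%N then SGpos l else 0))).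
Proof.
rewrite -/positive_series.
have P0 : coefps 0 positive_series = 1.
  by rewrite raddfD /= [X in _ + X]/coefps /= addr0.
have /fps_mulIr dlog :
    map_fps (@theta rat) (fps_log positive_series) * positive_series =
    map_fps (@theta rat) connected_series * positive_series.
  by rewrite -theta_positive_series map_fps_log //; apply: thetaM.
have -> : CSG k = coefps k connected_series by rewrite [RHS]/coefps /= hk.
apply/fpsP => -[|n].
  (* [theta] kills the coefficient of [z^0], which is 0 on both sides. *)
  rewrite coef_connected_series connected_enum_void coef0 mul0r.
  rewrite (coef_fps_log P0 (leqnn k)) raddf_sum big_add1 big_mkord.
  rewrite big1 // => m _ /=.
  rewrite linearZ /= coefps0_exp ?mulr0 // => l.
  have -> : coefps 0 (coefps l (positive_series - 1)) =
    coefps 0 (coefps l positive_series) - coefps 0 (coefps l 1) by [].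
  rewrite coef_positive_series !coefps1.
  by rewrite positive_enum_void coef1 divr1; case: l => [|l]; rewrite subrr.
have /fpsP/(_ k)/fpsP/(_ n.+1) := dlog P0.
rewrite !coef_map_fps !coef_theta => /(mulfI _) -> //.
by rewrite pnatr_eq0.
Qed.
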